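(* There exists a function $\alpha = \alpha(k) > 0$ with $\alpha(k) \to 0$ as $k \to \infty$ such that for every fixed integer $k \geq 2$ and every sufficiently large integer $n$ the following holds. If $q \geq (4 + \alpha) n/(k\log k)$ is an integer, then in the $(1:q)$ Client-Waiter game played on $E(K_n)$, Waiter has a strategy to ensure that Client's graph is $k$-colorable. On the other hand, if $q \leq (\log 2/2 - \alpha) n/(k \log k)$ is a positive integer, then in the $(1:q)$ Client-Waiter game played on $E(K_n)$, Client has a strategy to build a non-$k$-colorable graph.
   Context: $\log$ denotes the natural logarithm. The $(1:q)$ Client-Waiter game on the board $E(K_n)$ is played as follows: in each round Waiter offers Client some number $s$ of previously unoffered (free) edges with $1 \le s \le q+1$ (if fewer free edges remain, he offers at most those); Client claims one of the offered edges and Waiter claims the remaining $s-1$. The game ends when all edges are claimed. Client's graph is the graph on $V(K_n)$ formed by the edges Client claimed. *)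

(* Defs.v *)
From mathcomp Require Import all_boot.

Set Implicit Arguments.
Unset Strict Implicit.
Unset Printing Implicit Defensive.

Section ClientWaiterGame.
Variables (T : finType) (q : nat) (B : {set T}).

(* A round is a pair (offer, element claimed by Client); Waiter claims the rest
   of the offer.  A history lists the rounds with the MOST RECENT ONE FIRST, so
   that the tail of a history is the position before its last round. *)
Definition round : Type := ({set T} * T)%type.
Definition history : Type := seq round.

Definition unoffered (h : history) : {set T} :=
  [set x in B | all (fun r : round => x \notin r.1) h].

Definition legal_offer (h : history) (A : {set T}) : bool :=
  (A \subset unoffered h) && (1 <= #|A| <= q.+1).

Fixpoint legal (h : history) : bool :=
  if h is (A, e) :: h' then [&& legal h', legal_offer h' A & e \in A]
  else true.

Definition completed (h : history) : bool := legal h && (unoffered h == set0).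

Definition client_claimed (h : history) : {set T} :=
  [set e in [seq r.2 | r <- h]].

Definition waiter_strategy : Type := history -> {set T}.
Definition client_strategy : Type := history -> {set T} -> T.

Definition legal_waiter (S : waiter_strategy) : Prop :=
  forall h, legal h -> unoffered h != set0 -> legal_offer h (S h).

Definition legal_client (S : client_strategy) : Prop :=
  forall h A, legal h -> legal_offer h A -> S h A \in A.

Fixpoint follows_waiter (S : waiter_strategy) (h : history) : Prop :=
  if h is (A, _) :: h' then follows_waiter S h' /\ A = S h' else True.

Fixpoint follows_client (S : client_strategy) (h : history) : Prop :=
  if h is (A, e) :: h' then follows_client S h' /\ e = S h' A else True.

Definition waiter_can_ensure (P : {set T} -> Prop) : Prop :=
  exists2 S : waiter_strategy, legal_waiter S &
    forall h, completed h -> follows_waiter S h -> P (client_claimed h).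

Definition client_can_ensure (P : {set T} -> Prop) : Prop :=
  exists2 S : client_strategy, legal_client S &
    forall h, completed h -> follows_client S h -> P (client_claimed h).

End ClientWaiterGame.

Definition edges_complete (n : nat) : {set {set 'I_n}} :=
  [set e : {set 'I_n} | #|e| == 2].

Definition colorable (n k : nat) (G : {set {set 'I_n}}) : Prop :=
  exists c : 'I_n -> 'I_k,
    forall x y : 'I_n, x != y -> [set x; y] \in G -> c x != c y.

(* Main.v *)
(* Waiter exposes the vertices one at a time, offering only edges from the new
   vertex to the earlier, already coloured ones.  At least half of the colour
   classes have size at most 2n/k.  As long as m of these classes carry no edge
   claimed by Client from the new vertex, Waiter offers (q+1)/m edges to each of
   them; this exhausts classes of size up to q (1/2 + 1/3 + ... + 1/m), about
   q log k, before all are hit, so some colour stays available.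

   Client prevents independent sets of size about n/k: a uniformly random Client
   misses a given such set with probability at most (q/(q+1))^C(n/k, 2), which
   beats the union bound (ek)^(n/k), and the expectation argument is
   derandomized by a potential.

   Both arguments have room to spare once log k >= 8; for the finitely many
   smaller k, alpha is so large that q >= 2n in the first part, and that the
   second part is void. *)
Require Import Defs.
From HB Require Import structures.
From mathcomp Require Import all_boot all_order all_algebra.
From mathcomp Require Import boolp.
From mathcomp Require Import zify ring lra.
Import Order.TTheory GRing.Theory Num.Theory.

Set Implicit Arguments.
Unset Strict Implicit.
Unset Printing Implicit Defensive.

(** * Reduction of plays to positions, and Waiter's box game *)

Section Positions.
Variables (T : finType) (q : nat).
Implicit Types (B F C A S D : {set T}) (h : history T).

Lemma unoffered_cons B h A e :
  unoffered B ((A, e) :: h) = unoffered B h :\: A.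
Proof.
by apply/setP=> x; rewrite !inE /=; case: (x \in A); rewrite /= ?andbF // andbT.
Qed.

Lemma unoffered_nil B : unoffered B [::] = B.
Proof. by apply/setP=> x; rewrite !inE andbT. Qed.

Lemma client_claimed_cons h A (e : T) :
  client_claimed ((A, e) :: h) = e |: client_claimed h.
Proof. by apply/setP=> x; rewrite !inE. Qed.

Lemma client_claimed_nil : client_claimed ([::] : history T) = set0.
Proof. by apply/setP=> x; rewrite !inE. Qed.

(** [F] holds the free elements and [C] those of Client. An inductive predicate on positions lets
    partial strategies be chained by [waiter_reaches_bind] without mentioning histories. *)
Inductive waiter_reaches (Q : {set T} -> {set T} -> Prop) :
    {set T} -> {set T} -> Prop :=
| reaches_stop F C : Q F C -> waiter_reaches Q F C
| reaches_offer F C A : A \subset F -> 1 <= #|A| <= q.+1 ->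
    (forall e, e \in A -> waiter_reaches Q (F :\: A) (e |: C)) ->
    waiter_reaches Q F C.

Lemma waiter_reaches_bind (Q Q' : {set T} -> {set T} -> Prop) F C :
  waiter_reaches Q F C ->
  (forall F' C', Q F' C' -> waiter_reaches Q' F' C') ->
  waiter_reaches Q' F C.
Proof.
move=> reachQ QQ'; elim: reachQ => {}F {}C; first exact: QQ'.
by move=> A AF cA _ IH; apply: reaches_offer IH.
Qed.

Lemma waiter_can_ensure_reaches B (P : {set T} -> Prop) :
  waiter_reaches (fun F C => F = set0 /\ P C) B set0 -> waiter_can_ensure q B P.
Proof.
set Q := fun F C => _ => winB.
pose good F C A := [/\ A \subset F, 1 <= #|A| <= q.+1 &
   forall e, e \in A -> waiter_reaches Q (F :\: A) (e |: C)].
pose St h := if pselect (exists A, good (unoffered B h) (client_claimed h) A)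
  is left p then sval (cid p)
  else if [pick x in unoffered B h] is Some x then [set x] else set0.
exists St => [h _ h0|h /andP[lh /eqP h0] fh].
  rewrite /legal_offer /St; case: pselect => [p|_].
    by case: (cid p) => A [/= -> ->].
  case: pickP => [x xh|nox]; first by rewrite sub1set xh cards1.
  by case/set0Pn: h0 => x; rewrite nox.
(* Offers are nonempty, so with no free element left only [reaches_stop] is possible. *)
suff {h0} : waiter_reaches Q (unoffered B h) (client_claimed h).
  rewrite h0; move Ez: set0 => F reach; case: reach Ez => {}F C; first by case.
  move=> A + + _ E; rewrite -E subset0 => /eqP ->; by rewrite cards0.
elim: h lh fh => [|[A e] h IH].
  by rewrite unoffered_nil client_claimed_nil.
move=> /= /and3P[lh lA eA] [fh EA].
rewrite unoffered_cons client_claimed_cons.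
suff [_ _] : good (unoffered B h) (client_claimed h) A by apply.
rewrite {1}EA /St; case: pselect => [p|nop]; first by case: (cid p).
case: nop; have := IH lh fh.
move: lA; rewrite /legal_offer.
move: (unoffered B h) (client_claimed h) => F C lA reach.
case: reach lA => {}F {}C; last by move=> A' ? ? ? _; exists A'.
case=> -> _ /andP[]; rewrite subset0 => /eqP ->; by rewrite cards0.
Qed.

(** Client picks an element that preserves the invariant; [x0] is the default value on an empty
    offer. *)
Lemma client_can_ensure_invariant B (P : {set T} -> Prop)
    (Inv : {set T} -> {set T} -> Prop) (x0 : T) :
  Inv B set0 ->
  (forall F C A, Inv F C -> A \subset F -> 1 <= #|A| <= q.+1 ->
     exists2 e, e \in A & Inv (F :\: A) (e |: C)) ->
  (forall C, Inv set0 C -> P C) -> client_can_ensure q B P.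
Proof.
move=> InvB step InvP.
pose good h A e := e \in A /\ Inv (unoffered B h :\: A) (e |: client_claimed h).
pose St h A := if pselect (exists e, good h A e) is left p then sval (cid p)
  else if [pick x in A] is Some x then x else x0.
exists St => [h A _ /andP[_ /andP[A1 _]]|h /andP[lh /eqP h0] fh].
  rewrite /St; case: pselect => [p|_]; first by case: (cid p) => e [].
  case: pickP => // noA; have /set0Pn[x] : A != set0 by rewrite -card_gt0.
  by rewrite noA.
apply: InvP; rewrite -h0 => {h0}.
elim: h lh fh => [|[A e] h IH].
  by rewrite unoffered_nil client_claimed_nil.
move=> /= /and3P[lh /andP[Ah cA] eA] [fh Ee].
rewrite unoffered_cons client_claimed_cons.
suff [] : good h A e by [].
rewrite Ee /St; case: pselect => [p|nop]; first by case: (cid p).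
by case: nop; have [e' ? ?] := step _ _ _ (IH lh fh) Ah cA; exists e'.
Qed.

Lemma waiter_reaches_clear F C S : S \subset F ->
  waiter_reaches
    (fun F' C' => F' = F :\: S /\ exists2 D : {set T}, D \subset S & C' = C :|: D) F C.
Proof.
move: {2}#|S| (leqnn #|S|) => s; elim: s F C S => [|s IH] F C S sS SF.
  move: sS; rewrite leqn0 cards_eq0 => /eqP ->; apply: reaches_stop.
  by rewrite setD0; split=> //; exists set0; rewrite ?setU0.
have [->|/set0Pn[x xS]] := eqVneq S set0.
  by apply: reaches_stop; rewrite setD0; split=> //; exists set0; rewrite ?setU0.
apply: (@reaches_offer _ _ _ [set x]); rewrite ?cards1 ?sub1set //.
  exact: subsetP xS.
move=> _ /set1P ->.
apply: (waiter_reaches_bind (IH _ (x |: C) (S :\ x) _ (setSD _ SF))).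
  by move: sS; rewrite (cardsD1 x S) xS.
move=> F' C' [-> [D DS ->]]; apply: reaches_stop; split.
  by rewrite setDDl setD1K.
exists (x |: D); last by rewrite setUCA setUA.
by rewrite subUset sub1set xS (subset_trans DS) ?subD1set.
Qed.

(** With [i] boxes alive, a round removes up to [q.+1 %/ i] elements from each. The sum starts at 2
    because the last box must already be empty. *)
Definition box_capacity m := \sum_(2 <= i < m.+1) q.+1 %/ i.

Lemma box_capacityS m : 0 < m ->
  box_capacity m.+1 = box_capacity m + q.+1 %/ m.+1.
Proof. by move=> m0; rewrite /box_capacity big_nat_recr. Qed.

Lemma subset_of_card S t :
  exists2 A : {set T}, A \subset S & #|A| <= t /\ #|S :\: A| <= #|S| - t.
Proof.
have [tS|St] := leqP t #|S|.
  have [A /andP[AS /eqP cA]] : exists A : {set T}, (A \subset S) && (#|A| == t).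
    have : 0 < #|[set A : {set T} | A \subset S & #|A| == t]|.
      by rewrite cards_draws bin_gt0.
    by rewrite card_gt0 => /set0Pn[A]; rewrite inE; exists A.
  by exists A => //; rewrite cA cardsD (setIidPr AS) cA.
by exists S; rewrite ?setDv ?cards0 ?(ltnW St).
Qed.

(* Waiter offers [(q + 1) / m] elements of each of the [m] boxes that Client has
   not hit; Client hits one of them, and [m - 1] boxes remain. *)
Lemma waiter_keeps_box (I : finType) (col : T -> I) m (U : {set I}) F C S :
  #|U| = m.+1 ->
  (forall j, j \in U -> #|[set e in S | col e == j]| <= box_capacity m.+1) ->
  S \subset F ->
  waiter_reaches (fun F' C' => F' = F :\: S /\
    exists2 j, j \in U & exists2 D : {set T}, D \subset S &
      C' = C :|: D /\ (forall e, e \in D -> col e != j)) F C.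
Proof.
elim: m U F C S => [|m IH] U F C S cU box SF.
  have /cards1P[j Ej] : #|U| == 1 by rewrite cU.
  have nocol e : e \in S -> col e != j.
    move=> eS; apply/negP=> ej; have := box j; rewrite Ej set11 => /(_ isT).
    rewrite /box_capacity big_geq // leqn0 cards_eq0 => /eqP/setP/(_ e).
    by rewrite !inE eS ej.
  apply: (waiter_reaches_bind (waiter_reaches_clear C SF)) => F' C' [-> [D DS ->]].
  apply: reaches_stop; split=> //; exists j; rewrite ?Ej ?set11 //.
  by exists D => //; split=> // e eD; apply: nocol; apply: subsetP eD.
pose t := q.+1 %/ m.+2.
pose part j := sval (cid2 (subset_of_card [set e in S | col e == j] t)).
have partP j : [/\ part j \subset [set e in S | col e == j], #|part j| <= t
    & #|[set e in S | col e == j] :\: part j| <=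
      #|[set e in S | col e == j]| - t].
  by rewrite /part; case: cid2 => A ? []; split.
pose A := \bigcup_(j in U) part j.
have partE j e : e \in part j -> e \in S /\ col e = j.
  by case: (partP j) => /subsetP sub _ _ /sub; rewrite inE => /andP[-> /eqP].
have AS : A \subset S by apply/bigcupsP=> j _; apply/subsetP=> e /partE[].
have cA : #|A| <= q.+1.
  apply: (@leq_trans (\sum_(j in U) t)).
    apply: (@leq_trans (\sum_(j in U) #|part j|)).
      rewrite /A; elim/big_rec2: _ => [|j n B _ le]; first by rewrite cards0.
      by apply: leq_trans (leq_card_setU _ _) _; rewrite leq_add2l.
    by apply: leq_sum => j _; case: (partP j).
  by rewrite sum_nat_const cU mulnC leq_trunc_div.
have restP u : u \in U -> #|U :\ u| = m.+1 /\ (forall j, j \in U :\ u ->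
    #|[set e in S :\: A | col e == j]| <= box_capacity m.+1).
  move=> uU; split; first by move: cU; rewrite (cardsD1 u) uU => -[].
  move=> j /setD1P[_ jU]; have [_ _ le] := partP j.
  apply: (@leq_trans #|[set e in S | col e == j] :\: part j|).
    apply: subset_leq_card; apply/subsetP=> e; rewrite !inE.
    case/andP=> /andP[eA ->] ->; rewrite !andbT; apply: contra eA => ej.
    by apply/bigcupP; exists j.
  apply: leq_trans le _; rewrite leq_subLR addnC -box_capacityS //.
  exact: box.
(* An empty offer is illegal; but then the reduced bounds hold already, and a box is dropped without
   playing a round. *)
have [A0|/set0Pn A0] := eqVneq A set0.
  have /set0Pn[u uU] : U != set0 by rewrite -card_gt0 cU.
  have [cu bu] := restP u uU.
  have bu' j : j \in U :\ u -> #|[set e in S | col e == j]| <= box_capacity m.+1.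
    by move=> ju; rewrite -[S]setD0 -A0; apply: bu.
  apply: (waiter_reaches_bind (IH _ F C S cu bu' SF)).
  move=> F' C' [-> [j /setD1P[_ jU] DP]]; apply: reaches_stop.
  by split=> //; exists j.
apply: (reaches_offer (A := A)) => [||e eA].
- exact: subset_trans SF.
- by rewrite cA andbT card_gt0; apply/set0Pn.
have [u uU eu] := bigcupP eA; have [eS ce] := partE _ _ eu.
have [cu bu] := restP u uU.
apply: (waiter_reaches_bind (IH _ (F :\: A) (e |: C) _ cu bu (setSD _ SF))).
move=> F' C' [-> [j /setD1P[ju jU] [D DS [-> Dj]]]]; apply: reaches_stop.
split; first by rewrite setDDl -[in RHS](setID S A) (setIidPr AS).
exists j => //; exists (e |: D).
  by rewrite subUset sub1set eS (subset_trans DS) ?subsetDl.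
split=> [|x /setU1P[->|]]; first by rewrite setUCA setUA.
  by rewrite ce eq_sym.
exact: Dj.
Qed.
End Positions.

(** * Waiter's colouring, vertex by vertex *)

Section Coloring.
Variables (n k q : nat).

(* Vertices are exposed in increasing order: [edges_from i] contains the edges
   not yet offered after the edges inside {0, ..., i - 1} are gone. *)
Definition edges_from i : {set {set 'I_n}} :=
  [set e in edges_complete n | [exists x in e, i <= x]].

(** The boxes are the edges from the new vertex to each colour class. As [c] is total, unexposed
    vertices carry arbitrary colours; these only make a class larger than its box. *)
Lemma waiter_colors :
  (forall c : 'I_n -> 'I_k, exists2 U : {set 'I_k}, U != set0 &
     forall j, j \in U -> #|[set x | c x == j]| <= box_capacity q #|U|) ->
  0 < k -> waiter_can_ensure q (edges_complete n) (fun G => colorable k G).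
Proof.
move=> boxes k0; apply: waiter_can_ensure_reaches.
pose Q i (F C : {set {set 'I_n}}) := F = edges_from i /\ exists c : 'I_n -> 'I_k,
  (forall e x, e \in C -> x \in e -> x < i) /\
  (forall x y, x != y -> [set x; y] \in C -> c x != c y).
suff QP i : i <= n -> waiter_reaches q (Q i) (edges_complete n) set0.
  apply: (waiter_reaches_bind (QP n (leqnn n))) => F C [-> [c [_ cP]]].
  apply: reaches_stop; split; last by exists c.
  apply/setP=> e; rewrite !inE; apply/negP => /andP[_ /existsP[x /andP[_]]].
  by rewrite leqNgt ltn_ord.
elim: i => [_|i IH lt_in].
  apply: reaches_stop; split.
    apply/setP=> e; rewrite !inE; case: (boolP (#|e| == 2)) => //= /eqP e2.
    have /set0Pn[x xe] : e != set0 by rewrite -card_gt0 e2.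
    by symmetry; apply/existsP; exists x; rewrite xe.
  by exists (fun=> Ordinal k0); split=> [e x|x y _]; rewrite inE.
apply: (waiter_reaches_bind (IH (ltnW lt_in))) => F C [-> [c [Ci cP]]].
pose v := Ordinal lt_in.
pose S := [set [set v; y] | y : 'I_n & y < i].
have SF : S \subset edges_from i.
  apply/subsetP=> _ /imsetP[y yi ->]; rewrite !inE cards2.
  have -> /= : v != y by apply/eqP=> vy; rewrite inE -vy ltnn in yi.
  by apply/existsP; exists v; rewrite !inE eqxx /=.
(* The earlier endpoint of an edge at [v], whose colour names the box; the default [v] never occurs
   on [S]. *)
pose other (e : {set 'I_n}) := odflt v [pick y in e | y != v].
have otherE (y : 'I_n) : y < i -> other [set v; y] = y.
  move=> yi; rewrite /other; case: pickP => [z|/(_ y)] /=.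
    by rewrite !inE => /andP[/orP[/eqP->|/eqP->//]]; rewrite eqxx.
  rewrite !inE eqxx orbT /= => /negbFE/eqP Ey; move: yi; by rewrite Ey ltnn.
have [U U0 boxU] := boxes c.
have [m Em] : exists m, #|U| = m.+1.
  by exists #|U|.-1; rewrite prednK // card_gt0.
have boxS j : j \in U ->
    #|[set e in S | c (other e) == j]| <= box_capacity q m.+1.
  move=> jU; rewrite -Em; apply: leq_trans (boxU j jU).
  rewrite -(card_in_imset (f := other)).
    apply: subset_leq_card; apply/subsetP=> _ /imsetP[e + ->].
    by rewrite !inE => /andP[].
  move=> e1 e2; rewrite !inE => /andP[/imsetP[y1 y1i ->] _].
  case/andP=> /imsetP[y2 y2i ->] _.
  by rewrite !inE in y1i y2i; rewrite !otherE // => ->.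
apply: (waiter_reaches_bind (waiter_keeps_box C Em boxS SF)).
move=> F' C' [-> [j _ [D DS [-> Dj]]]]; apply: reaches_stop; split.
  apply/setP=> e; rewrite !inE.
  case: (boolP (#|e| == 2)) => [/cards2P[x [y [xy ->]]]|_]; last by rewrite andbF.
  have inS : ([set x; y] \in S) =
      ((x == v) && (y < i) || (y == v) && (x < i)).
    apply/imsetP/orP => [[z]|[/andP[/eqP-> yi]|/andP[/eqP-> xi]]].
    - rewrite inE => zi /setP E.
      have := E v; rewrite !inE eqxx /= => /orP[] /eqP Ev.
        left; rewrite -Ev eqxx; have := E y; rewrite !inE eqxx orbT Ev.
        by rewrite [y == x]eq_sym (negPf xy) => /esym/eqP ->.
      right; rewrite -Ev eqxx; have := E x; rewrite !inE eqxx Ev (negPf xy).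
      by move=> /esym/eqP ->.
    - by exists y; rewrite ?inE.
    - by exists x; rewrite ?inE // setUC.
  have ex2 l : [exists z in [set x; y], l <= z] = (l <= x) || (l <= y).
    apply/existsP/orP => [[z]|[lx|ly]].
    - by rewrite !inE => /andP[/orP[/eqP->|/eqP->] ->]; [left|right].
    - by exists x; rewrite !inE eqxx.
    - by exists y; rewrite !inE eqxx orbT.
  rewrite inS !ex2 -!(inj_eq val_inj) /=.
  have : (x : nat) != y by [].
  lia.
(* The new vertex takes the colour [j] of the box that Client never hit. *)
exists (fun x => if x == v then j else c x); split.
  move=> e x /setUP[eC xe|/(subsetP DS)/imsetP[y]].
    exact: leqW (Ci _ _ eC xe).
  by rewrite inE => yi -> /set2P[->|->] //; apply: leqW.
have star y : y != v -> [set v; y] \in C :|: D -> c y != j.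
  move=> yv /setUP[eC|eD].
    by have := Ci _ v eC; rewrite set21 ltnn => /(_ isT).
  have /imsetP[z] := subsetP DS _ eD; rewrite inE => zi E.
  have yz : y = z.
    by have := set22 v y; rewrite E => /set2P[] // /eqP; rewrite (negPf yv).
  by have := Dj _ eD; rewrite yz otherE.
move=> x y xy; case: (eqVneq x v) => [xv|xv]; case: (eqVneq y v) => [yv|yv].
- by rewrite xv yv eqxx in xy.
- by rewrite xv => vy; rewrite eq_sym; apply: star vy.
- by rewrite yv setUC => vx; apply: star vx.
case/setUP; first exact: cP.
move/(subsetP DS)/imsetP=> [z _ E].
have := set21 v z; rewrite -E => /set2P[] /eqP; rewrite eq_sym.
  by rewrite (negPf xv).
by rewrite (negPf yv).
Qed.
End Coloring.

(** * Client's potential function *)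

Section Transversal.
Local Open Scope ring_scope.
Variables (R : realFieldType) (T : finType) (q : nat).
Hypothesis q_gt0 : (0 < q)%N.

Let w : R := q%:R / q.+1%:R.

(** Induction on [j]: the step reduces to [s - j <= q + 1], which is where the bound on the offer
    size enters. *)
Lemma bernoulli_weight s j a : (j <= s <= q.+1)%N ->
  (s - j)%:R * w ^+ a <= s%:R * w ^+ (a + j).
Proof.
have w0 : 0 <= w by rewrite divr_ge0.
case/andP=> js sq; rewrite exprD mulrA mulrAC ler_wpM2r ?exprn_ge0 //.
elim: j js => [|j IH js]; first by rewrite subn0 expr0 mulr1.
rewrite exprSr [leRHS]mulrA; apply: le_trans (ler_wpM2r w0 (IH (ltnW js))).
rewrite /w mulrA ler_pdivlMr ?ltr0n // -!natrM ler_nat.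
by move: js sq; nia.
Qed.

(* A uniformly random claim hits a set with [j] offered elements with
   probability at least [j / (q + 1)], so that the expected number of sets
   missed by a random Client, weighted by [w] for each free element, does not
   increase; Client derandomizes. *)
Lemma client_transversal (I : finType) (P : pred I) (A : I -> {set T})
    (B : {set T}) (x0 : T) :
  \sum_(i | P i) w ^+ #|A i :&: B| < 1 ->
  client_can_ensure q B (fun C => forall i, P i -> ~~ [disjoint A i & C]).
Proof.
move=> small; have w0 : 0 <= w by rewrite divr_ge0.
pose pot (F C : {set T}) := \sum_(i | P i && [disjoint A i & C]) w ^+ #|A i :&: F|.
apply: (@client_can_ensure_invariant _ _ _ _ (fun F C => pot F C < 1)) => //.
- rewrite /pot (eq_bigl P) // => i.
  by rewrite -setI_eq0 setI0 eqxx andbT.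
- move=> F C O potFC OF /andP[O0 Oq].
  have key : \sum_(e in O) pot (F :\: O) (e |: C) <= #|O|%:R * pot F C.
    rewrite /pot mulr_sumr.
    rewrite (exchange_big_dep (fun i => P i && [disjoint A i & C])) /=; last first.
      move=> e i _ /andP[-> ] /=; apply: disjointWr.
      by apply/subsetP=> x; rewrite !inE => ->; rewrite orbT.
    apply: ler_sum => i /andP[Pi dAC].
    (* A set missed so far stays missed exactly for the claims outside it. *)
    rewrite (eq_bigl [in O :\: A i]); last first.
      move=> e; rewrite !inE Pi /= -!setI_eq0 setIUr setU_eq0.
      rewrite (_ : A i :&: C == set0) ?andbT; last by rewrite setI_eq0.
      by rewrite setI_eq0 disjoint_sym disjoints1 andbC.
    rewrite sumr_const -[leLHS]mulr_natl cardsD.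
    have -> : #|A i :&: F| = (#|A i :&: (F :\: O)| + #|O :&: A i|)%N.
      rewrite -(cardsID O (A i :&: F)) addnC; congr (_ + _)%N.
        by rewrite setIDA.
      by rewrite -setIA (setIidPr OF) setIC.
    by apply: bernoulli_weight; rewrite Oq subset_leq_card ?subsetIl.
  apply: contrapT => noe.
  suff : #|O|%:R <= \sum_(e in O) pot (F :\: O) (e |: C).
    apply/negP; rewrite -ltNge; apply: le_lt_trans key _.
    by rewrite -[ltRHS]mulr1 ltr_pM2l ?ltr0n.
  rewrite -sum1_card natr_sum; apply: ler_sum => e eO.
  by rewrite leNgt; apply/negP => lt1; apply: noe; exists e.
(* With nothing free, each missed set contributes [w ^+ 0 = 1] to the potential. *)
- move=> C lt1 i Pi; apply/negP => dis; move: lt1; rewrite ltNge => /negP; apply.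
  rewrite /pot (bigD1 i) ?Pi //= setI0 cards0 expr0 lerDl.
  by apply: sumr_ge0 => j _; rewrite exprn_ge0.
Qed.
End Transversal.

(** * Colour classes: a large one for Client, many small ones for Waiter *)

Lemma pigeonhole_class n k t (c : 'I_n -> 'I_k) :
  k * t < n -> exists j, t < #|[set x | c x == j]|.
Proof.
move=> ktn; apply/existsP; apply: contraTT ktn => /existsPn small.
rewrite -leqNgt -[n]card_ord -sum1_card (partition_big c predT) //=.
rewrite -[k in k * t]card_ord -sum_nat_const leq_sum // => j _.
by rewrite sum1dep_card leqNgt small.
Qed.

(** Client claims an edge inside every set of [t.+1] vertices, while any [k]-colouring has a class
    that contains such a set. *)
Lemma client_not_colorable (R : realFieldType) n k q t :
  0 < q -> k * t < n ->
  ('C(n, t.+1)%:R * (q%:R / q.+1%:R) ^+ 'C(t.+1, 2) < 1 :> R)%R ->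
  client_can_ensure q (edges_complete n) (fun G => ~ colorable k G).
Proof.
move=> q0 ktn small.
pose A (X : {set 'I_n}) := [set e : {set 'I_n} | e \subset X & #|e| == 2].
have [|S legS winS] := @client_transversal R _ q q0 _
  (fun X : {set 'I_n} => #|X| == t.+1) A (edges_complete n) set0.
  rewrite (eq_bigr (fun=> (q%:R / q.+1%:R) ^+ 'C(t.+1, 2)))%R => [|X /eqP cX].
    rewrite sumr_const.
    have := card_draws 'I_n t.+1; rewrite cardsE card_ord => ->.
    by rewrite -[ltLHS]mulr_natl.
  rewrite (setIidPl _) ?cards_draws ?cX //.
  by apply/subsetP=> e; rewrite !inE => /andP[].
exists S => // h ch fh [c cP].
have [j tj] := pigeonhole_class c ktn.
have [X /andP[Xj cX]] : exists X : {set 'I_n},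
    (X \subset [set x | c x == j]) && (#|X| == t.+1).
  have : 0 < #|[set X : {set 'I_n} | X \subset [set x | c x == j] & #|X| == t.+1]|.
    by rewrite cards_draws bin_gt0.
  by rewrite card_gt0 => /set0Pn[X]; rewrite inE; exists X.
have := winS h ch fh X cX; rewrite -setI_eq0 => /set0Pn[e /setIP[]].
rewrite inE => /andP[eX /cards2P[x [y [xy Ee]]]] eC.
have colj z : z \in e -> c z = j.
  by move=> /(subsetP eX) /(subsetP Xj); rewrite inE => /eqP.
have := cP x y xy; rewrite -Ee => /(_ eC).
by rewrite !colj ?eqxx // Ee !inE eqxx ?orbT.
Qed.

(** Markov's inequality: the classes sum to [n], so at most half of them exceed twice the
    average. *)
Lemma small_classes n k (c : 'I_n -> 'I_k) : 0 < n ->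
  k <= 2 * #|[set j | k * #|[set x | c x == j]| <= 2 * n]|.
Proof.
move=> n0; set U := [set j | _].
have sumE : \sum_j #|[set x | c x == j]| = n.
  rewrite -[RHS]card_ord -[RHS]sum1_card (partition_big c predT) //=.
  by apply: eq_bigr => j _; rewrite sum1dep_card.
have UC : #|U| + #|~: U| = k by rewrite cardsC card_ord.
have : \sum_(j in ~: U) 2 * n <= \sum_j k * #|[set x | c x == j]|.
  rewrite [leqRHS](bigID [in ~: U]) /= -[leqLHS]addn0 leq_add // leq_sum // => j.
  by rewrite !inE -ltnNge => /ltnW.
rewrite sum_nat_const -big_distrr /= sumE.
rewrite mulnA leq_pmul2r //; move: UC; move: #|U| #|~: U| => u v; lia.
Qed.


From mathcomp Require Import all_classical all_reals all_analysis.
Import numFieldNormedType.Exports.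
Local Open Scope classical_set_scope.
Local Open Scope ring_scope.

(** * Bounds on binomial coefficients and logarithms *)

Section Estimates.
Variable R : realType.

(** A weak form of Stirling's formula, by induction from [(1 + 1/t)^t <= e]. *)
Lemma pow_self_le_fact_expR t : t%:R ^+ t <= t`!%:R * expR t%:R :> R.
Proof.
elim: t => [|t IH]; first by rewrite expr0 fact0 mul1r expR0.
have step : t.+1%:R ^+ t <= t%:R ^+ t * expR 1 :> R.
  case: t {IH} => [|t]; first by rewrite !expr0 mul1r; apply: le_trans (expR_ge1Dx _); rewrite lerDl.
  rewrite -[X in expR X](@divff _ t.+1%:R) ?pnatr_eq0 // expRM_natl -exprMn.
  rewrite lerXn2r ?nnegrE ?mulr_ge0 ?expR_ge0 //.
  apply: (@le_trans _ _ (t.+1%:R * (1 + t.+1%:R^-1))); last first.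
    by rewrite ler_wpM2l ?expR_ge1Dx.
  by rewrite mulrDr mulr1 divff ?pnatr_eq0 // natr1.
rewrite exprS factS natrM -mulrA ler_wpM2l //.
apply: le_trans step _; rewrite -natr1 expRD mulrA.
by rewrite ler_wpM2r ?expR_ge0.
Qed.

Lemma ffact_le_expn n m : (n ^_ m <= n ^ m)%N.
Proof.
elim: m => // m IH; rewrite ffactnSr expnSr leq_mul //; exact: leq_subr.
Qed.

(** The right side is [(e k)^s], which bounds [n^s / s!] because [n <= k s]. *)
Lemma bin_le_expR n k s : (0 < k)%N -> (0 < s)%N -> (n <= k * s)%N ->
  'C(n, s)%:R <= expR (s%:R * (1 + ln k%:R)) :> R.
Proof.
move=> k0 s0 nks; rewrite expRM_natl expRD lnK ?posrE ?ltr0n // exprMn.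
have s0' : 0 < s%:R ^+ s :> R by rewrite exprn_gt0 ?ltr0n.
rewrite -(ler_pM2r s0') -expRM_natl mulr1.
have := ler_wpM2l (ler0n R 'C(n, s)) (pow_self_le_fact_expR s).
move=> H; apply: le_trans H _; rewrite mulrA -natrM bin_ffact mulrC -mulrA.
rewrite ler_wpM2l ?expR_ge0 // -exprMn -natrM -natrX ler_nat.
by apply: leq_trans (ffact_le_expn _ _) _; rewrite leq_exp2r.
Qed.

(** Since [q/(q+1) <= exp(-1/(q+1))], the product is at most the exponential of
    [(t+1)(1 + ln k) - (t+1)t/(2(q+1))], which is negative by assumption. *)
Lemma bin_weight_lt1 n k q t : (0 < k)%N -> (n <= k * t.+1)%N ->
  2 * q.+1%:R * (1 + ln k%:R) < t%:R :> R ->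
  'C(n, t.+1)%:R * (q%:R / q.+1%:R) ^+ 'C(t.+1, 2) < 1 :> R.
Proof.
move=> k0 nkt qt.
have w0 : 0 <= q%:R / q.+1%:R :> R by rewrite divr_ge0.
have q0 : 0 < q.+1%:R :> R by rewrite ltr0n.
have wle : q%:R / q.+1%:R <= expR (- q.+1%:R^-1) :> R.
  apply: le_trans (expR_ge1Dx _).
  by rewrite ler_pdivrMr // mulrDl mul1r mulNr mulVf ?gt_eqF // -natr1 addrK.
have bin2E : 'C(t.+1, 2)%:R = t.+1%:R * t%:R / 2 :> R.
  have /(congr1 (fun m => m%:R : R)) := mul_bin_diag t.+1 1.
  by rewrite bin1 !natrM /= => ->; rewrite mulrC mulKf.
apply: (@le_lt_trans _ _ (expR (t.+1%:R * (1 + ln k%:R)) *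
                          expR (- q.+1%:R^-1) ^+ 'C(t.+1, 2))).
  rewrite ler_pM ?exprn_ge0 ?bin_le_expR //.
  by rewrite lerXn2r ?nnegrE ?expR_ge0.
rewrite -expRM_natl -expRD expR_lt1 bin2E.
have -> : t.+1%:R * (1 + ln k%:R) + t.+1%:R * t%:R / 2 * - q.+1%:R^-1 =
  t.+1%:R / (2 * q.+1%:R) * (2 * q.+1%:R * (1 + ln k%:R) - t%:R) :> R.
  by field; rewrite gt_eqF.
by rewrite pmulr_rlt0 ?subr_lt0 // divr_gt0 ?ltr0n // mulr_gt0.
Qed.

(** The logarithm telescopes through [ln (i+1) - ln i <= 1/i]; each floor loses at most 1, whence
    the term [m]. *)
Lemma box_capacity_ge q m : (0 < m)%N ->
  q.+1%:R * (ln m.+1%:R - 1) - m%:R <= (box_capacity q m)%:R :> R.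
Proof.
have q0 : 0 < q.+1%:R :> R by rewrite ltr0n.
case: m => // m _; elim: m => [|m IH].
  rewrite /box_capacity big_geq // lerBlDr add0r.
  apply: (@le_trans _ _ 0) => //; rewrite pmulr_rle0 // subr_le0.
  by have := @le_ln1Dx R 1; apply; lra.
rewrite box_capacityS // natrD.
have m0 : 0 < m.+2%:R :> R by rewrite ltr0n.
have lnS : ln m.+3%:R <= ln m.+2%:R + m.+2%:R^-1 :> R.
  have -> : m.+3%:R = m.+2%:R * (1 + m.+2%:R^-1) :> R.
    by rewrite mulrDr mulr1 divff ?gt_eqF // natr1.
  rewrite lnM ?posrE ?addr_gt0 ?invr_gt0 // lerD2l le_ln1Dx //.
  by apply: lt_trans (_ : 0 < _); rewrite ?invr_gt0 ?oppr_lt0.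
have floor : q.+1%:R * m.+2%:R^-1 - 1 <= (q.+1 %/ m.+2)%:R :> R.
  rewrite lerBlDr natr1 ler_pdivrMr // -natrM ler_nat.
  by rewrite ltnW // ltn_ceil.
have := ler_wpM2l (ltW q0) lnS; rewrite mulrDr => lnS'.
have mS : m.+2%:R = m.+1%:R + 1 :> R by rewrite natr1.
move: IH floor lnS'; rewrite !mulrBr !mulr1.
move: (_ * ln m.+3%:R) (_ * ln m.+2%:R) (_ * m.+2%:R^-1) => a b d.
rewrite mS; lra.
Qed.

(** [2 <= (6/5)^4 <= exp(4/5)]. *)
Lemma ln2_le : ln 2 <= 4 / 5 :> R.
Proof.
rewrite -[leRHS]expRK ler_ln ?posrE ?expR_gt0 //.
have -> : 4 / 5 = 4%:R * (1 / 5) :> R by field.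
rewrite expRM_natl; apply: (@le_trans _ _ ((1 + 1 / 5) ^+ 4)); first by lra.
by rewrite lerXn2r ?nnegrE ?expR_ge0 ?expR_ge1Dx //; lra.
Qed.
End Estimates.

(** * The two bounds, for small and for large [k] *)

Lemma waiter_colors_small (n k q : nat) : (1 < k)%N -> (2 * n <= q.+1)%N ->
  waiter_can_ensure q (edges_complete n) (fun G => colorable k G).
Proof.
move=> k1 nq; apply: waiter_colors; last exact: ltnW.
move=> c; exists [set: 'I_k]%SET; first by rewrite -card_gt0 cardsT card_ord ltnW.
(* The first term [q.+1 %/ 2] alone is at least [n], more than any class needs. *)
move=> j _; rewrite cardsT card_ord /box_capacity big_ltn //.
apply: leq_trans (leq_addr _ _); apply: leq_trans (max_card _) _.
by rewrite card_ord leq_divRL // mulnC.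
Qed.

Section LargeK.
Variables (R : realType) (k n : nat).
Hypothesis lnk : 8 <= ln k%:R :> R.

Let k_gt0 : (0 < k)%N.
Proof. by case: k lnk => //; rewrite ln0 //; lra. Qed.

Lemma waiter_colors_large q : (0 < n)%N -> (k * k <= n)%N ->
  4 * n%:R / (k%:R * ln k%:R) <= q%:R :> R ->
  waiter_can_ensure q (edges_complete n) (fun G => colorable k G).
Proof.
move=> n0 kkn qge; have k0 : 0 < k%:R :> R by rewrite ltr0n.
apply: waiter_colors => // c; have kU := small_classes c n0.
set U := finset _ in kU.
have U0 : (0 < #|U|)%N by move: kU k_gt0; move: #|U| => u; lia.
exists U; first by rewrite -card_gt0.
have Uk : (#|U| <= k)%N by rewrite -[leqRHS]card_ord max_card.
move=> j; rewrite inE => jU; rewrite -(ler_nat R).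
apply: le_trans (box_capacity_ge R q U0).
have le2 : #|[set x | c x == j]%SET|%:R <= 2 * n%:R / k%:R :> R.
  by rewrite ler_pdivlMr // mulrC -!natrM ler_nat.
have lnU : ln k%:R - 1 <= ln #|U|.+1%:R :> R.
  have -> : ln #|U|.+1%:R = ln (2 * #|U|.+1%:R) - ln 2 :> R.
    by rewrite lnM ?posrE ?ltr0n // addrC addKr.
  apply: lerB; last by have := ln2_le R; lra.
  rewrite ler_ln ?posrE ?mulr_gt0 ?ltr0n //.
  by rewrite -natrM ler_nat; move: kU; move: #|U| => u; lia.
have L0 : 0 < ln k%:R :> R by apply: lt_le_trans lnk.
(* As [ln k >= 8], [ln k - 2 >= 3/4 * ln k]. Of the resulting [3n/k], the rounding loss takes at
   most [n/k], leaving the [2n/k] that a small class needs. *)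
have key : 3 * n%:R / k%:R <= q.+1%:R * (ln #|U|.+1%:R - 1) :> R.
  apply: (@le_trans _ _ (4 * n%:R / (k%:R * ln k%:R) * (3 / 4 * ln k%:R))).
    rewrite le_eqVlt; apply/orP; left; apply/eqP; field.
    by rewrite !gt_eqF.
  apply: ler_pM; rewrite ?divr_ge0 ?mulr_ge0 ?ler0n ?(ltW L0) //.
    by apply: le_trans qge _; rewrite ler_nat.
  move: lnU lnk; lra.
have : #|U|%:R <= n%:R / k%:R :> R.
  rewrite ler_pdivlMr // -natrM ler_nat; apply: leq_trans kkn.
  by rewrite leq_mul2r Uk orbT.
move: le2 key; rewrite -!mulrA; lra.
Qed.

Lemma client_not_colorable_large q : (0 < q)%N ->
  10 * k%:R * (3 + 2 * ln k%:R) < n%:R :> R ->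
  q%:R <= ln 2 / 2 * n%:R / (k%:R * ln k%:R) :> R ->
  client_can_ensure q (edges_complete n) (fun G => ~ colorable k G).
Proof.
move=> q0 nlarge qle; have k0 : 0 < k%:R :> R by rewrite ltr0n.
have n0 : (0 < n)%N.
  rewrite -(ltr0n R); apply: le_lt_trans nlarge.
  by apply: mulr_ge0; [rewrite mulr_ge0 | move: lnk; lra].
(* The largest [t] with [k * t < n]. *)
pose t := (n.-1 %/ k)%N.
have nkt : (n <= k * t.+1)%N.
  by rewrite mulnC -[n in (n <= _)%N]prednK // ltn_ceil.
apply: (@client_not_colorable R n k q t) => //.
  by rewrite mulnC -[ltnRHS]prednK // ltnS leq_trunc_div.
apply: (bin_weight_lt1 k_gt0 nkt).
have tge : n%:R / k%:R - 1 <= t%:R :> R.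
  by rewrite lerBlDr natr1 ler_pdivrMr // mulrC -natrM ler_nat.
apply: lt_le_trans tge.
(* This tenth of [n/k] absorbs the 1 lost in [t] and the [2 * (1 + ln k)] from replacing [q] by
   [q.+1]. *)
have n' : 3 + 2 * ln k%:R < n%:R / k%:R / 10 :> R.
  by rewrite ltr_pdivlMr // ltr_pdivlMr //; move: nlarge; lra.
have := lnk; set L := ln k%:R in n' qle * => L8; have L0 : 0 < L by lra.
(* The factor [9/10] is [4/5 * (1 + 1/8)], from [ln 2 <= 4/5] and [L >= 8]. *)
have q1 : 2 * q%:R * (1 + L) <= 9 / 10 * (n%:R / k%:R).
  apply: (@le_trans _ _ (2 * (ln 2 / 2 * n%:R / (k%:R * L)) * (1 + L))).
    by rewrite ler_wpM2r ?ler_wpM2l //; lra.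
  have -> : 2 * (ln 2 / 2 * n%:R / (k%:R * L)) * (1 + L) =
      ln 2 * (1 + L^-1) * (n%:R / k%:R).
    by field; rewrite !gt_eqF.
  rewrite ler_wpM2r ?divr_ge0 //.
  have LV8 : L^-1 <= 1 / 8 by rewrite -[_^-1]mul1r ler_pdivrMr //; lra.
  have -> : 9 / 10 = 4 / 5 * (1 + 1 / 8) :> R by field.
  rewrite ler_pM ?ln2_le ?lerD2l ?ln_ge0 //; try lra.
  by rewrite addr_ge0 // invr_ge0 ltW.
rewrite -natr1; move: n' q1; move: (n%:R / k%:R) => x.
lra.
Qed.
End LargeK.

Theorem theorem1p7 (R : realType) :
  exists alpha : nat -> R,
    [/\ forall k : nat, 0 < alpha k,
        alpha k @[k --> \oo] --> (0 : R) &
        forall k : nat, (2 <= k)%N ->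
          exists n0 : nat, forall n : nat, (n0 <= n)%N ->
            (forall q : nat,
               (4 + alpha k) * n%:R / (k%:R * ln (k%:R : R)) <= q%:R ->
               waiter_can_ensure q (edges_complete n)
                 (fun G => colorable k G)) /\
            (forall q : nat, (0 < q)%N ->
               q%:R <= (ln (2 : R) / 2 - alpha k) * n%:R
                         / (k%:R * ln (k%:R : R)) ->
               client_can_ensure q (edges_complete n)
                 (fun G => ~ colorable k G))].
Proof.
pose K := (Num.truncn (expR 8 : R)).+1.
have lnK8 k : (K <= k)%N -> 8 <= ln k%:R :> R.
  move=> Kk; have k0 : (0 < k)%N by apply: leq_trans Kk.
  rewrite -[leLHS]expRK ler_ln ?posrE ?expR_gt0 ?ltr0n //.
  apply: ltW; apply: lt_le_trans (truncnS_gt _) _.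
  by rewrite ler_nat.
(* For [K <= k] any positive null sequence serves. For smaller [k], the value forces [q >= 2n] in
   the first part and exceeds [ln 2 / 2] in the second, leaving no positive [q]. *)
exists (fun k => if (K <= k)%N then k.+1%:R^-1 else 1 + 2 * k%:R * ln k%:R).
split.
- move=> k; case: ifP => _; first by rewrite invr_gt0.
  case: k => [|k]; first by rewrite mulr0 mul0r addr0.
  by rewrite ltr_pwDl // !mulr_ge0 // ln_ge0 // ler1n.
- apply: cvg_trans (@cvg_harmonic R); apply: near_eq_cvg.
  by near=> k; rewrite ifT //; near: k; exact: nbhs_infty_ge.
move=> k k2; have k0 : 0 < k%:R :> R by rewrite ltr0n ltnW.
have L0 : 0 < ln k%:R :> R by rewrite ln_gt0 // ltr1n.
case: (boolP (K <= k)%N) => Kk.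
  have lnk := lnK8 _ Kk.
  have a0 : 0 <= k.+1%:R^-1 :> R by rewrite invr_ge0.
  exists (maxn (k * k) (Num.truncn (10 * k%:R * (3 + 2 * ln k%:R) : R)).+1) => n.
  rewrite geq_max => /andP[nkk nlarge].
  have n0 : (0 < n)%N by apply: leq_trans nlarge.
  split=> q => [qge|q0 qle].
    apply: (waiter_colors_large lnk n0 nkk); apply: le_trans qge.
    by rewrite ler_pM2r ?invr_gt0 ?mulr_gt0 // ler_wpM2r // lerDl.
  apply: (client_not_colorable_large lnk q0).
    by apply: lt_le_trans (truncnS_gt _) _; rewrite ler_nat.
  apply: le_trans qle _.
  by rewrite ler_pM2r ?invr_gt0 ?mulr_gt0 // ler_wpM2r // gerBl.
exists 0%N => n _; split=> q => [qge|q0 qle].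
  apply: waiter_colors_small => //; apply: leqW; rewrite -(ler_nat R).
  apply: le_trans qge; rewrite ler_pdivlMr ?mulr_gt0 // natrM.
  have : 0 <= n%:R :> R by [].
  nra.
exfalso; suff : q%:R <= 0 :> R by rewrite lern0 -leqn0 leqNgt q0.
apply: le_trans qle _; rewrite pmulr_lle0 ?invr_gt0 ?mulr_gt0 //.
rewrite mulr_le0_ge0 // subr_le0.
apply: (@le_trans _ _ 1); first by have := ln2_le R; lra.
by rewrite lerDl !mulr_ge0 // ltW.
Unshelve. all: by end_near.
Qed.
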